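(* Let $n,m\ge4$ and $N=n+m$, with all notation as in the context. Consider the fully interacted model $$A_{ij}=\eta+\delta Q_{ij}+\theta C_{ij}+(1-C_{ij})(\alpha_i+\alpha_j)+C_{ij}(\beta_i+\beta_j)+e_{ij},\qquad 1\le i<j\le N,$$ with the identifiability constraints $\sum_{i\le n}\alpha_i=\sum_{i>n}\alpha_i=\sum_{i\le n}\beta_i=\sum_{i>n}\beta_i=0$. Then: 1. The least-squares slope is $\widehat\theta=\mathcal E_{n,m}/2$. 2. The residual sum of squares is $\mathrm{RSS}_F=\mathrm{RSS}_{XY}+\mathrm{RSS}_{XX}+\mathrm{RSS}_{YY}$, where $$\mathrm{RSS}_{XY}=\|\Pi_nA^{XY}\Pi_m\|_F^2,\quad \mathrm{RSS}_{XX}=\operatorname{vec}_E(A^{XX})^{\mathsf T}M_{n,2}\operatorname{vec}_E(A^{XX}),\quad \mathrm{RSS}_{YY}=\operatorname{vec}_E(A^{YY})^{\mathsf T}M_{m,2}\operatorname{vec}_E(A^{YY}).$$ 3. The residual degrees of freedom are $$\nu_F=(n-1)(m-1)+\frac{n(n-3)}2+\frac{m(m-3)}2=\binom N2-2N+1.$$ 4. With $\mathrm{MS}_F=\mathrm{RSS}_F/\nu_F$, the Chakraborty–Zhang pooled variance estimator $S_{n,m}$ satisfies $S_{n,m}=4\,\mathrm{MS}_F$. Consequently, provided $\mathrm{RSS}_F>0$, the ordinary least-squares $t$-statistic for the slope $\theta$ is $$T_F=\frac{\widehat\theta}{a_{n,m}\sqrt{\mathrm{MS}_F}}=\frac{\mathcal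 E_{n,m}}{a_{n,m}\sqrt{S_{n,m}}},$$ which (under the same dissimilarity convention) is exactly the Chakraborty–Zhang studentized statistic. 5. The restricted model is nested in the fully interacted model (its fitted-value space is contained in that of the fully interacted model), and $$\mathrm{RSS}_R=\mathrm{RSS}_F+\mathrm{SS}_{\mathrm{int}},\qquad \mathrm{SS}_{\mathrm{int}}\ge0,\qquad \nu_R-\nu_F=N-2,$$ where $\mathrm{SS}_{\mathrm{int}}$ is the extra sum of squares explained by the endpoint-by-pair-type interactions.
   Context: Let $X_1,\dots,X_n$ and $Y_1,\dots,Y_m$ be independent samples from probability distributions $P$ and $Q$ on a common space $\mathcal Z$, and $\rho:\mathcal Z^2\to\mathbb R$ a symmetric measurable dissimilarity (with finite expectations $\mathbb E\rho(X,Y),\mathbb E\rho(X,X'),\mathbb E\rho(Y,Y')$ for mutually independent $X,X'\sim P$, $Y,Y'\sim Q$). Pool: $U_i=X_i$ for $i\le n$, $U_{n+j}=Y_j$ for $1\le j\le m$; $G_i=1$ for $i\le n$, $G_i=0$ for $i>n$. For $i\ne j$: $A_{ij}=\rho(U_i,U_j)$, $C_{ij}=\mathbf 1\{G_i\neq G_j\}$, $Q_{ij}=G_i+G_j-1$; $A$ and $C$ have zero diagonals. Edges are pairs $1\le i<j\le N$; for a symmetric zero-diagonal array $B$, $\operatorname{vec}_E(B)=(B_{ij})_{i<j}$; $a_E=\operatorname{vec}_E(A)$, $c_E=\operatorname{vec}_E(C)$. Energy statistic: $\mathcal E_{n,m}=2\overline A_{XY}-\overline A_{XX}-\overline A_{YY}$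 with $\overline A_{XY}=\frac1{nm}\sum_{i\le n<j}A_{ij}$, $\overline A_{XX}=\frac2{n(n-1)}\sum_{i<j\le n}A_{ij}$, $\overline A_{YY}=\frac2{m(m-1)}\sum_{n<i<j\le N}A_{ij}$. The constant $a_{n,m}>0$ is given by $a_{n,m}^2=\frac1{nm}+\frac1{2n(n-1)}+\frac1{2m(m-1)}$. Blocks: $A^{XX}=(A_{ij})_{1\le i,j\le n}$, $A^{XY}=(A_{i,n+j})_{1\le i\le n,\,1\le j\le m}$, $A^{YY}=(A_{n+i,n+j})_{1\le i,j\le m}$. $\Pi_s=I_s-\frac1s\mathbf 1_s\mathbf 1_s^{\mathsf T}$; $\|\cdot\|_F$ is the Frobenius norm. For $s\ge3$, $Z_s\in\mathbb R^{\binom s2\times s}$ is the matrix with $(Z_s)_{\{i,j\},k}=\mathbf 1\{k\in\{i,j\}\}$ and $M_{s,2}=I-Z_s(Z_s^{\mathsf T}Z_s)^{-1}Z_s^{\mathsf T}$. Restricted (common-endpoint) model: $a_E=Z_N\gamma+\theta c_E+e$, $\gamma\in\mathbb R^N$, $\theta\in\mathbb R$. Its residual sum of squares is $\mathrm{RSS}_R=a_E^{\mathsf T}M_{N,2}a_E-\widehat\theta^2/a_{n,m}^2$, where $\widehat\theta$ is its least-squares slope (also equal to $\mathcal E_{n,m}/2$), and its residual degrees of freedom are $\nu_R=\binom N2-N-1$. If $\widehat f_R$ and $\widehat f_F$ denote the least-squares fitted edge vectors of the restricted and fully interacted models, $\mathrm{SS}_{\mathrm{int}}:=\|\widehat f_F-\widehat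 f_R\|^2$. Residual degrees of freedom means $\binom N2$ minus the dimension of the fitted-value space. The ordinary least-squares $t$-statistic of a slope is the estimate divided by its usual homoskedastic standard error, i.e. the square root of (residual mean square) times (the squared norm of the vector $w$ in the fitted-value space for which the estimate equals $w^{\mathsf T}a_E$). Chakraborty–Zhang pooled variance estimator: with $v_s=s(s-3)/2$, $$S_{n,m}=\frac{4(n-1)(m-1)\,\mathrm{cdCov}^2_{n,m}(X,Y)+4v_n\widetilde{\mathcal D}_n^2(X,X)+4v_m\widetilde{\mathcal D}_m^2(Y,Y)}{(n-1)(m-1)+v_n+v_m},$$ where $\mathrm{cdCov}^2_{n,m}(X,Y)=\|\Pi_nA^{XY}\Pi_m\|_F^2/\{(n-1)(m-1)\}$, $\widetilde{\mathcal D}_n^2(X,X)=\frac1{n(n-3)}\sum_{i\ne j}(\widetilde A^{XX}_{ij})^2$, $\widetilde{\mathcal D}_m^2(Y,Y)=\frac1{m(m-3)}\sum_{i\ne j}(\widetilde A^{YY}_{ij})^2$. Here, for a symmetric $s\times s$ zero-diagonal array $B$ with $B_{i\cdot}=\sum_{j\ne i}B_{ij}$, $B_{\cdot\cdot}=\sum_{i\ne j}B_{ij}$, the U-centered array is $\widetilde B_{ij}=B_{ij}-\frac{B_{i\cdot}+B_{j\cdot}}{s-2}+\frac{B_{\cdot\cdot}}{(s-1)(s-2)}$ for $i\neq j$, $\widetilde B_{ii}=0$. The Chakraborty–Zhang studentized statistic is $\mathcal E_{n,m}/(a_{n,m}\sqrt{S_{n,m}})$. *)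

(* Defs.v *)
From HB Require Import structures.
From mathcomp Require Import all_boot all_order all_algebra.
From mathcomp Require Import all_classical all_reals all_analysis.
From mathcomp Require Import ring.

Set Implicit Arguments.
Unset Strict Implicit.
Unset Printing Implicit Defensive.

Import Order.TTheory GRing.Theory Num.Theory.

Local Open Scope classical_set_scope.
Local Open Scope ring_scope.

(* X_1, ..., X_n, Y_1, ..., Y_m |-> U_1, ..., U_(n+m), indexed from 0. *)
Definition pool (T : Type) (n m : nat) (x : 'I_n -> T) (y : 'I_m -> T)
    (i : 'I_(n + m)) : T :=
  match fintype.split i with inl k => x k | inr k => y k end.

(* The sets B i range over all measurable sets, setT included, so the product
   rule over the whole index set contains the one over each subfamily. *)
Definition mutually_independent (R : realType) (d d' : measure_display)
    (Om : measurableType d) (Z : measurableType d') (Pr : probability Om R)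
    (I : finType) (U : I -> Om -> Z) : Prop :=
  forall B : I -> set Z, (forall i, measurable (B i)) ->
    Pr [set w | forall i, B i (U i w)] =
      (\prod_i fine (Pr [set w | B i (U i w)]))%:E.

Definition two_samples (R : realType) (d d' : measure_display)
    (Om : measurableType d) (Z : measurableType d') (Pr : probability Om R)
    (P Q : probability Z R) (n m : nat)
    (X : 'I_n -> {mfun Om >-> Z}) (Y : 'I_m -> {mfun Om >-> Z}) : Prop :=
  [/\ mutually_independent Pr
        (pool (fun i => X i : Om -> Z) (fun j => Y j : Om -> Z)),
      forall i B, measurable B -> distribution Pr (X i) B = P B
    & forall j B, measurable B -> distribution Pr (Y j) B = Q B].

(* The expectations of rho are taken under the product laws, that is, for
   independent arguments. *)
Definition dissimilarity (R : realType) (d : measure_display)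
    (Z : measurableType d) (P Q : probability Z R) (rho : Z -> Z -> R) : Prop :=
  let r := fun z : Z * Z => rho z.1 z.2 in
  [/\ forall z z', rho z z' = rho z' z,
      measurable_fun [set: Z * Z] r,
      (P \x Q)%E.-integrable [set: Z * Z] (EFin \o r),
      (P \x P)%E.-integrable [set: Z * Z] (EFin \o r)
    & (Q \x Q)%E.-integrable [set: Z * Z] (EFin \o r)].

Section Edges.
Variable R : realType.

Definition edge (s : nat) := {e : 'I_s * 'I_s | (e.1 < e.2)%N}.

(* Provably 'C(s, 2): see nedgeE below. *)
Definition nedge (s : nat) : nat := #|{: edge s}|.

Definition esrc (s : nat) (k : 'I_(nedge s)) : 'I_s := (val (enum_val k)).1.
Definition etgt (s : nat) (k : 'I_(nedge s)) : 'I_s := (val (enum_val k)).2.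

Definition vecE (s : nat) (B : 'M[R]_s) : 'cV[R]_(nedge s) :=
  \col_k B (esrc k) (etgt k).

Definition sqnorm (p q : nat) (B : 'M[R]_(p, q)) : R :=
  \sum_i \sum_j B i j ^+ 2.

Definition dot (p : nat) (u v : 'cV[R]_p) : R := (u^T *m v) 0 0.

Definition quad (p : nat) (M : 'M[R]_p) (v : 'cV[R]_p) : R :=
  (v^T *m M *m v) 0 0.

Definition Zmx (s : nat) : 'M[R]_(nedge s, s) :=
  \matrix_(e, k) ((k == esrc e) || (k == etgt e))%:R.

Definition M2 (s : nat) : 'M[R]_(nedge s) :=
  1%:M - Zmx s *m invmx ((Zmx s)^T *m Zmx s) *m (Zmx s)^T.

Definition centering (s : nat) : 'M[R]_s := 1%:M - const_mx (s%:R^-1).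

End Edges.

Lemma nedgeE (s : nat) : nedge s = 'C(s, 2).
Proof.
rewrite /nedge card_sig -sum1_card.
rewrite (eq_bigl (fun e : 'I_s * 'I_s => (e.1 < e.2)%N)) //.
rewrite -(pair_big_dep xpredT (fun i j : 'I_s => (i < j)%N) (fun _ _ => 1%N)).
rewrite (exchange_big_dep xpredT) //= -bin2_sum [RHS]big_mkord.
apply: eq_bigr => j _.
by rewrite -(big_ord_widen s (fun=> 1%N)) ?sum1_card ?card_ord // ltnW.
Qed.

Section Arrays.
Variables (R : realType) (n m : nat).

Definition glabel (i : 'I_(n + m)) : R := (i < n)%N%:R.

Definition Amx (T : Type) (rho : T -> T -> R) (u : 'I_(n + m) -> T) :
    'M[R]_(n + m) :=
  \matrix_(i, j) if i == j then 0 else rho (u i) (u j).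

Definition Cmx : 'M[R]_(n + m) := \matrix_(i, j) (glabel i != glabel j)%:R.

Definition Qmx : 'M[R]_(n + m) := \matrix_(i, j) (glabel i + glabel j - 1).

Definition blockXX (A : 'M[R]_(n + m)) : 'M[R]_n := ulsubmx A.
Definition blockXY (A : 'M[R]_(n + m)) : 'M[R]_(n, m) := ursubmx A.
Definition blockYY (A : 'M[R]_(n + m)) : 'M[R]_m := drsubmx A.

Definition meanXY (A : 'M[R]_(n + m)) : R :=
  (n%:R * m%:R)^-1 * \sum_(i < n + m) \sum_(j < n + m | (i < n)%N && (n <= j)%N) A i j.
Definition meanXX (A : 'M[R]_(n + m)) : R :=
  2 / (n%:R * (n%:R - 1)) * \sum_(i < n + m) \sum_(j < n + m | (i < j)%N && (j < n)%N) A i j.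
Definition meanYY (A : 'M[R]_(n + m)) : R :=
  2 / (m%:R * (m%:R - 1)) * \sum_(i < n + m) \sum_(j < n + m | (n <= i)%N && (i < j)%N) A i j.

Definition energy (A : 'M[R]_(n + m)) : R :=
  2 * meanXY A - meanXX A - meanYY A.

Definition anm : R :=
  Num.sqrt (1 / (n%:R * m%:R) + 1 / (2 * n%:R * (n%:R - 1))
            + 1 / (2 * m%:R * (m%:R - 1))).

End Arrays.

Section CZ.
Variable R : realType.

Definition offrow (s : nat) (B : 'M[R]_s) (i : 'I_s) : R :=
  \sum_(j | j != i) B i j.
Definition offtot (s : nat) (B : 'M[R]_s) : R :=
  \sum_i \sum_(j | j != i) B i j.

Definition ucenter (s : nat) (B : 'M[R]_s) : 'M[R]_s :=
  \matrix_(i, j)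
    if i == j then 0
    else B i j - (offrow B i + offrow B j) / (s%:R - 2)
         + offtot B / ((s%:R - 1) * (s%:R - 2)).

Definition Dtilde2 (s : nat) (B : 'M[R]_s) : R :=
  (s%:R * (s%:R - 3))^-1 * \sum_i \sum_(j | j != i) ucenter B i j ^+ 2.

Definition cdCov2 (n m : nat) (B : 'M[R]_(n, m)) : R :=
  sqnorm (centering R n *m B *m centering R m) / ((n%:R - 1) * (m%:R - 1)).

Definition vdf (s : nat) : R := s%:R * (s%:R - 3) / 2.

Definition czvar (n m : nat) (A : 'M[R]_(n + m)) : R :=
  (4 * (n%:R - 1) * (m%:R - 1) * cdCov2 (blockXY A)
   + 4 * vdf n * Dtilde2 (blockXX A) + 4 * vdf m * Dtilde2 (blockYY A))
  / ((n%:R - 1) * (m%:R - 1) + vdf n + vdf m).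

Definition czstat (n m : nat) (A : 'M[R]_(n + m)) : R :=
  energy A / (anm R n m * Num.sqrt (czvar A)).

End CZ.

Section LinearModel.
Variables (R : realType) (k : nat) (pT : vectType R).

Record linmodel := LinModel {
  admissible : {vspace pT};
  lm_mean : 'Hom(pT, 'cV[R]_k)
}.

Implicit Types (M : linmodel) (a w : 'cV[R]_k) (p : pT).

Definition fitted_space M : {vspace 'cV[R]_k} := (lm_mean M @: admissible M)%VS.

Definition rss M a p : R := sqnorm (a - lm_mean M p).

Definition is_lse M a p : Prop :=
  p \in admissible M /\ forall q, q \in admissible M -> rss M a p <= rss M a q.

Definition resid_df M : R := k%:R - (\dim (fitted_space M))%:R.

Definition slope_vector M (slope : pT -> R) w : Prop :=
  w \in fitted_space M /\ forall a p, is_lse M a p -> slope p = dot w a.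

(* est : the estimate; ms : the residual mean square; w : the slope vector *)
Definition ols_tstat (est ms : R) w : R := est / Num.sqrt (ms * sqnorm w).

End LinearModel.

Section Models.
Variables (R : realType) (n m : nat).
Local Notation N := (n + m)%N.

(* (gamma, theta) *)
Definition rparam : vectType R := ('cV[R]_N * R^o)%type.
Definition rtheta (p : rparam) : R := p.2.

Definition rmean (p : rparam) : 'cV[R]_(nedge N) :=
  Zmx R N *m p.1 + rtheta p *: vecE (Cmx R n m).

(* (((eta, delta), theta), (alpha, beta)) *)
Definition fparam : vectType R :=
  (R^o * R^o * R^o * ('cV[R]_N * 'cV[R]_N))%type.
Definition feta (p : fparam) : R := p.1.1.1.
Definition fdelta (p : fparam) : R := p.1.1.2.
Definition ftheta (p : fparam) : R := p.1.2.
Definition falpha (p : fparam) (i : 'I_N) : R := p.2.1 i 0.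
Definition fbeta (p : fparam) (i : 'I_N) : R := p.2.2 i 0.

Definition fmean (p : fparam) : 'cV[R]_(nedge N) :=
  \col_e let i := esrc e in let j := etgt e in
    feta p + fdelta p * Qmx R n m i j + ftheta p * Cmx R n m i j
    + (1 - Cmx R n m i j) * (falpha p i + falpha p j)
    + Cmx R n m i j * (fbeta p i + fbeta p j).

Definition fconstr_type : vectType R := (R^o * R^o * (R^o * R^o))%type.

Definition fconstr (p : fparam) : fconstr_type :=
  ((\sum_(i < N | (i < n)%N) falpha p i, \sum_(i < N | (n <= i)%N) falpha p i),
   (\sum_(i < N | (i < n)%N) fbeta p i, \sum_(i < N | (n <= i)%N) fbeta p i)).

Lemma rmean_is_linear : linear rmean.
Proof.
move=> a p q; apply/matrixP => e j; rewrite /rmean /rtheta mulmxDr -scalemxAr.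
rewrite !mxE /= /GRing.scale /= !mulrDl !mulrDr !mulrA.
by rewrite addrACA.
Qed.
HB.instance Definition _ := GRing.isLinear.Build R rparam 'cV[R]_(nedge N) _
  rmean rmean_is_linear.

Lemma fmean_is_linear : linear fmean.
Proof.
move=> a p q; apply/matrixP => e j.
rewrite /fmean /feta /fdelta /ftheta /falpha /fbeta !mxE /= /GRing.scale /=.
ring.
Qed.
HB.instance Definition _ := GRing.isLinear.Build R fparam 'cV[R]_(nedge N) _
  fmean fmean_is_linear.

Lemma fconstr_is_linear : linear fconstr.
Proof.
have sumZ (P : pred 'I_N) a (u v : 'cV[R]_N) :
    \sum_(i | P i) (a *: u + v) i 0 =
    a * (\sum_(i | P i) u i 0) + \sum_(i | P i) v i 0.
  rewrite mulr_sumr -big_split /=; apply: eq_bigr => i _; by rewrite !mxE.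
by move=> a p q; rewrite /fconstr /falpha /fbeta /= !sumZ.
Qed.
HB.instance Definition _ := GRing.isLinear.Build R fparam fconstr_type _
  fconstr fconstr_is_linear.

Definition restricted_model : linmodel (nedge N) rparam :=
  LinModel fullv (linfun rmean).

Definition full_model : linmodel (nedge N) fparam :=
  LinModel (lker (linfun fconstr)) (linfun fmean).

Lemma mean_restrictedE (p : rparam) : lm_mean restricted_model p = rmean p.
Proof. exact: lfunE. Qed.

Lemma mean_fullE (p : fparam) : lm_mean full_model p = fmean p.
Proof. exact: lfunE. Qed.

Lemma admissible_fullP (p : fparam) :
  p \in admissible full_model <->
  [/\ \sum_(i < N | (i < n)%N) falpha p i = 0,
      \sum_(i < N | (n <= i)%N) falpha p i = 0,
      \sum_(i < N | (i < n)%N) fbeta p i = 0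
    & \sum_(i < N | (n <= i)%N) fbeta p i = 0].
Proof.
rewrite memv_ker lfunE /= /fconstr; split=> [/eqP[-> -> -> ->] //|].
by case=> -> -> -> ->.
Qed.

End Models.

(* Main.v *)
(* The fitted space of the full model consists of the edge vectors equal to
   [g i + g j] on pairs within a sample and to [x i + x j] on pairs across the
   samples, so the fit decouples over the three blocks: on XX and YY the
   residual is the U-centred array, which is the residual of the projection
   onto the range of the incidence matrix [Zmx], and on XY it is the doubly
   centred block.  The slope is read off by pairing with
     w = c_E / (n m) - 1_XX / (n (n - 1)) - 1_YY / (m (m - 1)),
   whose squared norm is [anm ^+ 2].  This vector already lies in the restricted
   fitted space and is orthogonal to the range of [Zmx], so both models have the
   same slope and the restricted residual is [M2 a - (w . a / |w| ^+ 2) w]. *)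

Require Import Defs.
From HB Require Import structures.
From mathcomp Require Import all_boot all_order all_algebra.
From mathcomp Require Import all_classical all_reals all_analysis.
From mathcomp Require Import ring lra.

Set Implicit Arguments.
Unset Strict Implicit.
Unset Printing Implicit Defensive.

Import Order.TTheory GRing.Theory Num.Theory.

Local Open Scope classical_set_scope.
Local Open Scope ring_scope.

(** * Euclidean geometry of least squares in a linear model *)

Section LeastSquares.
Variable R : realType.

Lemma dotE k (u v : 'cV[R]_k) : dot u v = \sum_i u i 0 * v i 0.
Proof. by rewrite /dot mxE; apply: eq_bigr => i _; rewrite mxE. Qed.

Lemma dotC k (u v : 'cV[R]_k) : dot u v = dot v u.
Proof. by rewrite !dotE; apply: eq_bigr => i _; rewrite mulrC. Qed.

Lemma dotDr k (u v w : 'cV[R]_k) : dot u (v + w) = dot u v + dot u w.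
Proof. by rewrite /dot mulmxDr mxE. Qed.

Lemma dotZr k c (u v : 'cV[R]_k) : dot u (c *: v) = c * dot u v.
Proof. by rewrite /dot -scalemxAr mxE. Qed.

Lemma dotBr k (u v w : 'cV[R]_k) : dot u (v - w) = dot u v - dot u w.
Proof. by rewrite /dot mulmxBr !mxE. Qed.

Lemma dotBl k (u v w : 'cV[R]_k) : dot (u - v) w = dot u w - dot v w.
Proof. by rewrite dotC dotBr dotC (dotC w v). Qed.

Lemma dotZl k c (u v : 'cV[R]_k) : dot (c *: u) v = c * dot u v.
Proof. by rewrite dotC dotZr dotC. Qed.

Lemma dot_mulmxr p q (u : 'cV[R]_p) (B : 'M[R]_(p, q)) v :
  dot u (B *m v) = dot (B^T *m u) v.
Proof. by rewrite /dot trmx_mul trmxK mulmxA. Qed.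

Lemma dot0l k (v : 'cV[R]_k) : dot 0 v = 0.
Proof. by rewrite /dot trmx0 mul0mx mxE. Qed.

Lemma sqnorm_dot k (v : 'cV[R]_k) : sqnorm v = dot v v.
Proof.
by rewrite dotE; apply: eq_bigr => i _; rewrite big_ord1 expr2.
Qed.

Lemma sqnorm_ge0 p q (B : 'M[R]_(p, q)) : 0 <= sqnorm B.
Proof. by apply: sumr_ge0 => i _; apply: sumr_ge0 => j _; exact: sqr_ge0. Qed.

Lemma sqnorm_eq0 p q (B : 'M[R]_(p, q)) : sqnorm B = 0 -> B = 0.
Proof.
move=> B0; apply/matrixP => i j; rewrite mxE; apply/eqP.
rewrite -sqrf_eq0; apply/eqP; move: j isT; apply: psumr_eq0P => [j _|].
  exact: sqr_ge0.
move: i isT; apply: psumr_eq0P => // i _; apply: sumr_ge0 => j _.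
exact: sqr_ge0.
Qed.

Lemma dot_eq0 k (v : 'cV[R]_k) : dot v v = 0 -> v = 0.
Proof.
by rewrite -sqnorm_dot => /sqnorm_eq0.
Qed.

Lemma sqnormD_orth k (u v : 'cV[R]_k) :
  dot u v = 0 -> sqnorm (u + v) = sqnorm u + sqnorm v.
Proof.
move=> uv; rewrite !sqnorm_dot dotDr !(dotC (u + v)) !dotDr (dotC v) uv.
by ring.
Qed.

Variables (k : nat) (pT : vectType R).
Implicit Types (M : linmodel k pT) (a r w v : 'cV[R]_k) (p : pT).

Lemma mean_fitted M p : p \in admissible M -> lm_mean M p \in fitted_space M.
Proof. exact: memv_img. Qed.

(** The normal equations. Moving from [p] by the optimal step [t] along [q] would lower the residual
    sum of squares by [dot r u ^+ 2 / dot u u], so minimality forces [dot r u = 0]; the converse is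
    Pythagoras. *)
Lemma lseP M a p : is_lse M a p <->
  p \in admissible M /\
  forall v, v \in fitted_space M -> dot (a - lm_mean M p) v = 0.
Proof.
split=> -[pM hp]; split=> //; [move=> v|move=> q qM].
  case/memv_imgP=> q qM ->.
  set r := a - _; set u := lm_mean M q.
  have [/dot_eq0 ->|u0] := eqVneq (dot u u) 0; first by rewrite dotC dot0l.
  pose t := dot r u / dot u u.
  have := hp _ (memvD pM (memvZ t qM)).
  rewrite /rss linearD linearZ /= opprD addrA -/u -/r => le.
  have : dot r u * t <= 0.
    have e : t * (t * dot u u) = dot r u * t by rewrite /t; field.
    move: le; rewrite !sqnorm_dot (dotBr (r - _)) !(dotBl r) !dotZl !dotZr.
    rewrite (dotC u r) e (mulrC t); lra.
  rewrite /t mulrA -expr2 ler_pdivrMr ?mul0r.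
    by move=> h; apply/eqP; rewrite -sqrf_eq0 eq_le h sqr_ge0.
  by rewrite lt_neqAle eq_sym u0 -sqnorm_dot sqnorm_ge0.
have -> : rss M a q = rss M a p + sqnorm (lm_mean M p - lm_mean M q).
  rewrite /rss -sqnormD_orth ?subrKA // hp // rpredB // mean_fitted //.
by rewrite lerDl sqnorm_ge0.
Qed.

(** A certificate free of parameters: exhibiting such an [r] gives both the existence of a minimiser
    and the residual of every minimiser, even when the parameters are not determined by the fit. *)
Definition lsq_residual M a r : Prop :=
  a - r \in fitted_space M /\ forall v, v \in fitted_space M -> dot r v = 0.

Lemma lsq_residual_lse M a r : lsq_residual M a r -> exists p, is_lse M a p.
Proof.
case=> /memv_imgP[p pM ap] r0; exists p; apply/lseP; split=> // v vM.
by rewrite -ap opprB addrC addrNK r0.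
Qed.

Lemma lse_residual M a r p :
  lsq_residual M a r -> is_lse M a p -> a - lm_mean M p = r.
Proof.
move=> [arM r0] /lseP[pM p0]; apply/eqP; rewrite -subr_eq0; apply/eqP.
have dM : a - lm_mean M p - r \in fitted_space M.
  by rewrite addrAC rpredB // mean_fitted.
by apply: dot_eq0; rewrite dotBl p0 // r0 // subr0.
Qed.

Lemma lse_rss M a r p : lsq_residual M a r -> is_lse M a p ->
  rss M a p = sqnorm r.
Proof. by move=> h1 h2; rewrite /rss (lse_residual h1 h2). Qed.

Variable slope : pT -> R.

(** As [w] lies in the fitted space, it is orthogonal to the residual and cannot tell the fit from
    the data. *)
Lemma slope_lse M w a p :
  w \in fitted_space M ->
  (forall q, q \in admissible M -> slope q = dot w (lm_mean M q)) ->
  is_lse M a p -> slope p = dot w a.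
Proof.
move=> wM slopeE /lseP[pM p0]; rewrite slopeE //; apply/eqP.
by rewrite eq_sym -subr_eq0 -dotBr dotC p0.
Qed.

Lemma slope_vectorW M w :
  w \in fitted_space M ->
  (forall q, q \in admissible M -> slope q = dot w (lm_mean M q)) ->
  slope_vector M slope w.
Proof. by move=> wM slopeE; split=> // a p; exact: slope_lse. Qed.

(* Both vectors are compared on the data [w - w'], which the model fits
   exactly. *)
Lemma slope_vector_uniq M w w' :
  slope_vector M slope w -> slope_vector M slope w' -> w = w'.
Proof.
move=> [wM hw] [w'M hw']; apply/eqP; rewrite -subr_eq0; apply/eqP.
have dM : w - w' \in fitted_space M by rewrite rpredB.
case/memv_imgP: (dM) => p pM wp.
have hp : is_lse M (w - w') p.
  by apply/lseP; split=> // v _; rewrite -wp subrr dot0l.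
by apply: dot_eq0; rewrite dotBl -(hw _ p) // -(hw' _ p) // subrr.
Qed.

End LeastSquares.

(** * Sums over edges, the block splitting, and the incidence matrix *)

Section EdgeSums.
Variable R : realType.

Lemma sum_edge s (f : 'I_s -> 'I_s -> R) :
  \sum_(e < nedge s) f (esrc e) (etgt e)
  = \sum_(i < s) \sum_(j < s | (i < j)%N) f i j.
Proof.
pose A := fun e : 'I_s * 'I_s => (e.1 < e.2)%N.
rewrite (pair_big_dep (I := 'I_s) (J := 'I_s) xpredT
           (fun i j => (i < j)%N) f) /=.
transitivity (\sum_(e in A) f e.1 e.2); last exact: eq_bigl.
transitivity (\sum_(e : edge s) f (val e).1 (val e).2).
  exact: (esym (big_enum_val (A := {: edge s})
                  (fun e : edge s => f (val e).1 (val e).2))).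
exact: (esym (big_sub A (fun e => f e.1 e.2))).
Qed.

Lemma edge_lt s (e : 'I_(nedge s)) : (esrc e < etgt e)%N.
Proof. exact: (valP (enum_val e)). Qed.

Lemma edge_neq s (e : 'I_(nedge s)) : esrc e != etgt e.
Proof. by rewrite -val_eqE ltn_eqF // edge_lt. Qed.

Lemma dot_vecE s (B D : 'M[R]_s) :
  dot (vecE B) (vecE D) = \sum_(i < s) \sum_(j < s | (i < j)%N) B i j * D i j.
Proof.
by rewrite dotE -(sum_edge (fun i j => B i j * D i j)); apply: eq_bigr => e _;
   rewrite !mxE.
Qed.

(** Edges run from the smaller to the larger index, so each cross pair is read once, from the upper
    right block. *)
Lemma dot_vecE_block n m (B : 'M[R]_(n + m)) a b c d :
  dot (vecE B) (vecE (block_mx a b c d)) =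
  dot (vecE (ulsubmx B)) (vecE a) + \sum_i \sum_j ursubmx B i j * b i j
  + dot (vecE (drsubmx B)) (vecE d).
Proof.
rewrite !dot_vecE big_split_ord -big_split /=; congr (_ + _);
  apply: eq_bigr => i _; rewrite big_split_ord /=.
  congr (_ + _).
    by apply: eq_bigr => j _; rewrite block_mxEul !mxE.
  apply: eq_big => [j|j _]; first by rewrite ltn_addr.
  by rewrite block_mxEur !mxE.
rewrite big_pred0 ?add0r => [|j]; last first.
  by rewrite ltnNge ltnW // ltn_addr.
apply: eq_big => [j|j _]; first by rewrite ltn_add2l.
by rewrite block_mxEdr !mxE.
Qed.

Lemma sqnorm_vecE_block n m (a : 'M[R]_n) b c (d : 'M[R]_m) :
  sqnorm (vecE (block_mx a b c d)) =
  sqnorm b + sqnorm (vecE a) + sqnorm (vecE d).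
Proof.
rewrite !sqnorm_dot dot_vecE_block block_mxKul block_mxKur block_mxKdr.
by rewrite [sqnorm b + _]addrC; do 2!congr (_ + _); apply: eq_bigr => i _;
   apply: eq_bigr => j _; rewrite expr2.
Qed.

Lemma sum_offdiag s (f : 'I_s -> 'I_s -> R) :
  (forall i j, f i j = f j i) ->
  \sum_i \sum_(j | j != i) f i j
  = 2 * \sum_(i < s) \sum_(j < s | (i < j)%N) f i j.
Proof.
move=> fC; rewrite mulr2n mulrDl mul1r.
rewrite [X in _ = _ + X](exchange_big_dep xpredT) //= -big_split /=.
apply: eq_bigr => i _.
rewrite (bigID (fun j : 'I_s => (i < j)%N)) /=; congr (_ + _).
  by apply: eq_bigl => j; rewrite -val_eqE /=; case: ltngtP.
by apply: eq_big => [j|j _ //]; rewrite -val_eqE /=; case: ltngtP.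
Qed.

Lemma Zmx_mul s (g : 'cV[R]_s) (e : 'I_(nedge s)) :
  (Zmx R s *m g) e 0 = g (esrc e) 0 + g (etgt e) 0.
Proof.
have lt := edge_lt e.
rewrite mxE (bigD1 (esrc e)) //= (bigD1 (etgt e)) /=; last first.
  by rewrite -val_eqE neq_ltn lt orbT.
rewrite !mxE !eqxx orbT !mul1r big1 ?addr0 // => k /andP[ks kt].
by rewrite mxE (negbTE ks) (negbTE kt) mul0r.
Qed.

Lemma Zmx_vecE s (g : 'cV[R]_s) :
  Zmx R s *m g = vecE (\matrix_(i, j) (g i 0 + g j 0)).
Proof. by apply/colP => e; rewrite Zmx_mul !mxE. Qed.

(** The adjoint of [Zmx] sends a symmetric array to its off-diagonal row sums. Doubling replaces the
    sum over edges by one over ordered pairs, where the two endpoints contribute equally. *)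
Lemma dot_vecE_Zmx s (B : 'M[R]_s) g : (forall i j, B i j = B j i) ->
  dot (vecE B) (Zmx R s *m g) = \sum_i offrow B i * g i 0.
Proof.
move=> BC; rewrite Zmx_vecE dot_vecE.
under eq_bigr do under eq_bigr do rewrite mxE mulrDr.
apply: (mulfI (_ : 2 != 0)); first by rewrite pnatr_eq0.
rewrite -sum_offdiag => [|i j]; last by rewrite BC addrC.
under eq_bigr do rewrite big_split /=.
rewrite big_split /= mulr2n mulrDl mul1r; congr (_ + _).
  by apply: eq_bigr => i _; rewrite mulr_suml.
rewrite (exchange_big_dep xpredT) //=; apply: eq_bigr => i _.
rewrite mulr_suml; apply: eq_big => [j|j _]; first by rewrite eq_sym.
by rewrite (BC j i).
Qed.

End EdgeSums.

(** * Projection off the endpoint effects, and U-centering *)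

Section EndpointProjection.
Variables (R : realType) (s : nat).
Hypothesis s_ge3 : (3 <= s)%N.

Let s1_neq0 : s%:R - 1 != 0 :> R.
Proof. by rewrite subr_eq0 pnatr_eq1; case: s s_ge3 => [|[]]. Qed.

Let s2_neq0 : s%:R - 2 != 0 :> R.
Proof. by rewrite subr_eq0 eqr_nat; case: s s_ge3 => [|[|[]]]. Qed.

Lemma offrowE (B : 'M[R]_s) i : offrow B i = \sum_j B i j - B i i.
Proof. by rewrite [\sum_j _](bigD1 i) //= addrC addrK. Qed.

(** Bilinear form of the Gram identity: $Z^T Z = (s-2) I + 1 1^T$. *)
Lemma dot_ZmxZmx (g h : 'cV[R]_s) : dot (Zmx R s *m g) (Zmx R s *m h) =
  (s%:R - 2) * dot g h + (\sum_i g i 0) * (\sum_i h i 0).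
Proof.
rewrite [in LHS]Zmx_vecE dot_vecE_Zmx => [|i j]; last by rewrite !mxE addrC.
rewrite dotE !mulr_sumr -big_split /=; apply: eq_bigr => i _.
rewrite offrowE mxE (eq_bigr (fun j => g i 0 + g j 0)) => [|j _]; last first.
  by rewrite mxE.
by rewrite big_split /= sumr_const card_ord -mulr_natr; ring.
Qed.

Lemma Zmx_inj (g : 'cV[R]_s) : Zmx R s *m g = 0 -> g = 0.
Proof.
move=> Zg0.
have S0 : \sum_i g i 0 = 0.
  (* Pairing with the constant vector gives $2(s-1)\sum_i g_i = 0$; once the sum vanishes, pairing
     [g] with itself leaves $(s-2)|g|^2 = 0$. *)
  have := dot_ZmxZmx g (const_mx 1); rewrite Zg0 dot0l dotE.
  under [in X in _ = _ * X + _]eq_bigr do rewrite mxE mulr1.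
  under [X in _ = _ + _ * X]eq_bigr do rewrite mxE.
  rewrite sumr_const card_ord => /eqP; rewrite mulrC -mulrDr eq_sym mulf_eq0.
  case/orP=> [/eqP //|]; rewrite (_ : _ + _ = 2 * (s%:R - 1)); last by ring.
  by rewrite mulf_eq0 (negbTE s1_neq0) pnatr_eq0.
have := dot_ZmxZmx g g; rewrite Zg0 dot0l S0 mul0r addr0 => /esym/eqP.
by rewrite mulf_eq0 (negbTE s2_neq0) => /eqP/dot_eq0.
Qed.

Lemma Zmx_gram_unit : (Zmx R s)^T *m Zmx R s \in unitmx.
Proof.
rewrite -row_free_unit; apply: inj_row_free => v vZ0.
apply: trmx_inj; rewrite trmx0; apply/Zmx_inj/dot_eq0.
rewrite dot_mulmxr (_ : _ *m _ = (v *m ((Zmx R s)^T *m Zmx R s))^T).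
  by rewrite vZ0 trmx0 dot0l.
by rewrite !trmx_mul trmxK mulmxA.
Qed.

Lemma M2_orth (a : 'cV[R]_(nedge s)) h : dot (M2 R s *m a) (Zmx R s *m h) = 0.
Proof.
rewrite dot_mulmxr mulmxA /M2 mulmxBr mulmx1 !mulmxA mulmxV ?Zmx_gram_unit //.
by rewrite mul1mx subrr mul0mx dot0l.
Qed.

Lemma M2_decomp (a : 'cV[R]_(nedge s)) :
  exists g, a - M2 R s *m a = Zmx R s *m g.
Proof.
rewrite /M2 mulmxBl mul1mx opprB addrC addrNK -!mulmxA.
by eexists; reflexivity.
Qed.

(** Two candidate residuals differ by an element of the range of [Zmx] that is also orthogonal to
    that range. This identifies [M2] without computing the inverse Gram matrix. *)
Lemma M2_unique (a r : 'cV[R]_(nedge s)) g : a - r = Zmx R s *m g ->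
  (forall h, dot r (Zmx R s *m h) = 0) -> M2 R s *m a = r.
Proof.
move=> ar r0; have [h ah] := M2_decomp a.
have e : M2 R s *m a - r = Zmx R s *m (g - h).
  by rewrite mulmxBr -ar -ah [RHS]addrAC subKr.
apply/eqP; rewrite -subr_eq0; apply/eqP/dot_eq0.
by rewrite {2}e dotBl M2_orth r0 subrr.
Qed.

Lemma quad_M2 (a : 'cV[R]_(nedge s)) : quad (M2 R s) a = sqnorm (M2 R s *m a).
Proof.
have [g ag] := M2_decomp a.
rewrite sqnorm_dot /quad -mulmxA -/(dot a _) -{1}[a](subrK (M2 R s *m a)) ag.
by rewrite dotC dotDr M2_orth add0r.
Qed.

Lemma ucenter_sym (B : 'M[R]_s) : (forall i j, B i j = B j i) ->
  forall i j, ucenter B i j = ucenter B j i.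
Proof.
move=> BC i j; rewrite !mxE eq_sym; case: eqP => // _.
by rewrite BC [offrow B i + _]addrC.
Qed.

(** The denominators [s - 2] and [(s - 1) * (s - 2)] of U-centering are the ones that annihilate the
    row sums; with [dot_vecE_Zmx] this is orthogonality to the range of [Zmx]. *)
Lemma offrow_ucenter (B : 'M[R]_s) i : (forall i j, B i j = B j i) ->
  offrow (ucenter B) i = 0.
Proof.
move=> BC; rewrite /offrow.
under eq_bigr => j ji do rewrite mxE eq_sym (negbTE ji).
have cst (c : R) : \sum_(j < s | j != i) c = c * (s%:R - 1).
  have e : s%:R = s.-1%:R + 1 :> R.
    by rewrite natr1 prednK // (ltn_trans _ s_ge3).
  by rewrite sumr_const cardC1 card_ord e addrK mulr_natr.
have tot : offtot B = offrow B i + \sum_(j | j != i) offrow B j.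
  by rewrite /offtot (bigD1 i).
rewrite big_split sumrB /= -mulr_suml big_split /= !cst.
rewrite -/(offrow B i) tot; field.
by rewrite s1_neq0 s2_neq0.
Qed.

Lemma vecE_ucenter_orth (B : 'M[R]_s) h : (forall i j, B i j = B j i) ->
  dot (vecE (ucenter B)) (Zmx R s *m h) = 0.
Proof.
move=> BC; rewrite dot_vecE_Zmx; last exact: ucenter_sym.
by rewrite big1 // => i _; rewrite offrow_ucenter // mul0r.
Qed.

Lemma ucenter_decomp (B : 'M[R]_s) : exists g : 'cV[R]_s,
  forall i j, i != j -> B i j - ucenter B i j = g i 0 + g j 0.
Proof.
(* The total is shared equally between the two endpoints, whence the extra factor 2. *)
exists (\col_i (offrow B i / (s%:R - 2)
               - offtot B / (2 * (s%:R - 1) * (s%:R - 2)))) => i j ij.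
by rewrite !mxE (negbTE ij); field; rewrite s1_neq0 s2_neq0.
Qed.

Lemma quad_M2_vecE (B : 'M[R]_s) : (forall i j, B i j = B j i) ->
  quad (M2 R s) (vecE B) = sqnorm (vecE (ucenter B)).
Proof.
move=> BC; have [g Bg] := ucenter_decomp B.
rewrite quad_M2 (M2_unique (r := vecE (ucenter B)) (g := g)) //.
  apply/colP => e; rewrite Zmx_mul -Bg ?edge_neq // [LHS]mxE.
  by rewrite [X in X + _ = _]mxE [X in _ + X = _]mxE [X in _ - X = _]mxE.
by move=> h; exact: vecE_ucenter_orth.
Qed.

End EndpointProjection.

(** [Dtilde2] sums over ordered pairs, which is twice the sum over edges; the 2 cancels the one in
    [vdf], and [4 <= s] keeps [s - 3] nonzero. *)
Lemma Dtilde2E (R : realType) s (B : 'M[R]_s) : (4 <= s)%N ->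
  (forall i j, B i j = B j i) ->
  4 * vdf R s * Dtilde2 B = 4 * quad (M2 R s) (vecE B).
Proof.
move=> s4 BC; have s3 : s%:R - 3 != 0 :> R.
  by rewrite subr_eq0 eqr_nat; case: s s4 {B BC} => [|[|[|[]]]].
rewrite quad_M2_vecE ?(ltnW s4) // /Dtilde2.
rewrite (sum_offdiag (f := fun i j => ucenter B i j ^+ 2)); last first.
  by move=> i j; rewrite ucenter_sym.
rewrite sqnorm_dot dot_vecE /vdf.
under [in RHS]eq_bigr do under eq_bigr do rewrite -expr2.
by field; rewrite s3 pnatr_eq0; case: s s4 {B BC s3}.
Qed.

(** * The two-sample design and its free parametrization *)

Section TwoSamples.
Variables (R : realType) (n m : nat).
Local Notation N := (n + m)%N.
Implicit Types (g x : 'cV[R]_N) (B : 'M[R]_N).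

Lemma glabel_lshift (i : 'I_n) : glabel R (lshift m i) = 1 :> R.
Proof. by rewrite /glabel /= ltn_ord. Qed.

Lemma glabel_rshift (j : 'I_m) : glabel R (rshift n j) = 0 :> R.
Proof. by rewrite /glabel /= ltnNge leq_addr. Qed.

Lemma Cmx_block : Cmx R n m = block_mx 0 (const_mx 1) (const_mx 1) 0.
Proof.
apply/matrixP => i j; rewrite mxE.
by case: (split_ordP i) => i' ->; case: (split_ordP j) => j' ->;
   rewrite ?glabel_lshift ?glabel_rshift ?block_mxEul ?block_mxEur ?block_mxEdl
     ?block_mxEdr !mxE ?eqxx // ?oner_eq0 // eq_sym oner_eq0.
Qed.

(* Free parametrization of the fitted space of the full model: a pair of nodes
   of the same sample gets [g i + g j], a pair across the samples gets
   [x i + x j]. *)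
Definition interaction_fit (p : 'cV[R]_N * 'cV[R]_N) : 'cV[R]_(nedge N) :=
  \col_e let i := esrc e in let j := etgt e in
    (1 - Cmx R n m i j) * (p.1 i 0 + p.1 j 0)
    + Cmx R n m i j * (p.2 i 0 + p.2 j 0).

Lemma interaction_fit_is_linear : linear interaction_fit.
Proof.
by move=> a p q; apply/matrixP => e j; rewrite /interaction_fit !mxE; ring.
Qed.
HB.instance Definition _ := GRing.isLinear.Build R
  ('cV[R]_N * 'cV[R]_N)%type 'cV[R]_(nedge N) _
  interaction_fit interaction_fit_is_linear.

Lemma interaction_fit_block g x : interaction_fit (g, x) =
  vecE (block_mx (\matrix_(i, j) (usubmx g i 0 + usubmx g j 0))
                 (\matrix_(i, j) (usubmx x i 0 + dsubmx x j 0))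
                 (\matrix_(i, j) (dsubmx x i 0 + usubmx x j 0))
                 (\matrix_(i, j) (dsubmx g i 0 + dsubmx g j 0))).
Proof.
apply/colP => e; rewrite [LHS]mxE [RHS]mxE Cmx_block /=.
by case: (split_ordP (esrc e)) => i ->; case: (split_ordP (etgt e)) => j ->;
   rewrite ?block_mxEul ?block_mxEur ?block_mxEdl ?block_mxEdr !mxE; ring.
Qed.

Lemma dot_interaction_fit B g x :
  dot (vecE B) (interaction_fit (g, x)) =
  dot (vecE (ulsubmx B)) (Zmx R n *m usubmx g)
  + \sum_i \sum_j ursubmx B i j * (usubmx x i 0 + dsubmx x j 0)
  + dot (vecE (drsubmx B)) (Zmx R m *m dsubmx g).
Proof.
rewrite interaction_fit_block dot_vecE_block !Zmx_vecE; congr (_ + _ + _).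
by apply: eq_bigr => i _; apply: eq_bigr => j _; rewrite [X in _ * X = _]mxE.
Qed.

(** The orthogonality test for full-model residuals, one condition per block: endpoint effects on XX
    and YY, row and column sums on XY. *)
Lemma dot_interaction_fit0 B g x :
  (forall h, dot (vecE (ulsubmx B)) (Zmx R n *m h) = 0) ->
  (forall h, dot (vecE (drsubmx B)) (Zmx R m *m h) = 0) ->
  (forall i, \sum_j ursubmx B i j = 0) ->
  (forall j, \sum_i ursubmx B i j = 0) ->
  dot (vecE B) (interaction_fit (g, x)) = 0.
Proof.
move=> hX hY hr hc; rewrite dot_interaction_fit hX hY add0r addr0.
under eq_bigr do under eq_bigr do rewrite mulrDr.
under eq_bigr do rewrite big_split /= -mulr_suml hr mul0r add0r.
by rewrite exchange_big big1 //= => j _; rewrite -mulr_suml hc mul0r.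
Qed.

(** * Block averages and the slope vector *)

Lemma sumXE (f : 'I_N -> R) :
  \sum_(i < N | (i < n)%N) f i = \sum_i f (lshift m i).
Proof.
rewrite big_split_ord /= [X in _ + X]big_pred0 ?addr0 => [|j]; last first.
  by rewrite ltnNge leq_addr.
by apply: eq_bigl => i; rewrite ltn_ord.
Qed.

Lemma sumYE (f : 'I_N -> R) :
  \sum_(i < N | (n <= i)%N) f i = \sum_j f (rshift n j).
Proof.
rewrite big_split_ord /= big_pred0 ?add0r => [|i]; last first.
  by rewrite leqNgt ltn_ord.
by apply: eq_bigl => j; rewrite leq_addr.
Qed.

Lemma meanXYE B :
  meanXY B = (n%:R * m%:R)^-1 * \sum_i \sum_j ursubmx B i j.
Proof.
rewrite /meanXY; congr (_ * _).
under eq_bigr do rewrite big_mkcondl.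
rewrite (bigID (fun i : 'I_N => (i < n)%N)) /=.
rewrite [X in _ + X]big1 => [|i]; last first.
  by move=> /negbTE ->; rewrite big1.
rewrite addr0 sumXE; apply: eq_bigr => i _; rewrite sumYE.
by apply: eq_bigr => j _; rewrite /= ltn_ord !mxE.
Qed.

Lemma meanXXE B : meanXX B =
  2 / (n%:R * (n%:R - 1)) * \sum_(i < n) \sum_(j < n | (i < j)%N) ulsubmx B i j.
Proof.
rewrite /meanXX; congr (_ * _).
rewrite (bigID (fun i : 'I_N => (i < n)%N)) /=.
rewrite [X in _ + X]big1 => [|i]; last first.
  rewrite -leqNgt => ni; rewrite big_pred0 // => j.
  by apply/negP => /andP[ij /(ltn_trans ij)]; rewrite ltnNge ni.
rewrite addr0 sumXE; apply: eq_bigr => i _.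
rewrite big_mkcondl /= sumXE [RHS]big_mkcond /=.
by apply: eq_bigr => j _; rewrite !mxE.
Qed.

Lemma meanYYE B : meanYY B =
  2 / (m%:R * (m%:R - 1)) * \sum_(i < m) \sum_(j < m | (i < j)%N) drsubmx B i j.
Proof.
rewrite /meanYY; congr (_ * _).
rewrite (bigID (fun i : 'I_N => (n <= i)%N)) /=.
rewrite [X in _ + X]big1 => [|i]; last first.
  by move=> /negbTE ->; rewrite big_pred0.
rewrite addr0 sumYE; apply: eq_bigr => i _.
rewrite big_split_ord /= big_pred0 ?add0r => [|j]; last first.
  rewrite leq_addr /=; apply: negbTE; rewrite -leqNgt.
  by rewrite (leq_trans (ltnW (ltn_ord j))) ?leq_addr.
apply: eq_big => [j|j _]; last by rewrite !mxE.
by rewrite leq_addr ltn_add2l.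
Qed.

(** A pair adds the values at its two endpoints, so these are half the weights wanted on
    within-sample pairs. *)
Definition slope_w_nodes : 'cV[R]_N :=
  col_mx (const_mx (- (2 * n%:R * (n%:R - 1))^-1))
         (const_mx (- (2 * m%:R * (m%:R - 1))^-1)).

Definition slope_w : 'cV[R]_(nedge N) :=
  interaction_fit (slope_w_nodes, const_mx (2 * n%:R * m%:R)^-1).


Hypotheses (n_ge3 : (3 <= n)%N) (m_ge3 : (3 <= m)%N).

Let n_neq0 : n%:R != 0 :> R.
Proof. by rewrite pnatr_eq0; case: n n_ge3. Qed.
Let n1_neq0 : n%:R - 1 != 0 :> R.
Proof. by rewrite subr_eq0 pnatr_eq1; case: n n_ge3 => [|[]]. Qed.
Let m_neq0 : m%:R != 0 :> R.
Proof. by rewrite pnatr_eq0; case: m m_ge3. Qed.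
Let m1_neq0 : m%:R - 1 != 0 :> R.
Proof. by rewrite subr_eq0 pnatr_eq1; case: m m_ge3 => [|[]]. Qed.

Lemma slope_wE : slope_w =
  vecE (block_mx (const_mx (- (n%:R * (n%:R - 1))^-1))
                 (const_mx (n%:R * m%:R)^-1) (const_mx (n%:R * m%:R)^-1)
                 (const_mx (- (m%:R * (m%:R - 1))^-1))).
Proof.
rewrite /slope_w interaction_fit_block; congr (vecE (block_mx _ _ _ _));
  apply/matrixP => i j; rewrite mxE [RHS]mxE.
- by rewrite col_mxKu !mxE; field; rewrite n_neq0 n1_neq0.
- by rewrite !mxE; field; rewrite n_neq0 m_neq0.
- by rewrite !mxE; field; rewrite n_neq0 m_neq0.
- by rewrite col_mxKd !mxE; field; rewrite m_neq0 m1_neq0.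
Qed.

Lemma dot_const_Zmx s (c : R) (g : 'cV[R]_s) :
  dot (vecE (const_mx c)) (Zmx R s *m g) = c * (s%:R - 1) * \sum_i g i 0.
Proof.
rewrite dot_vecE_Zmx => [|i j]; last by rewrite !mxE.
rewrite mulr_sumr; apply: eq_bigr => i _; rewrite offrowE mxE.
rewrite (eq_bigr (fun=> c)) => [|j _]; last by rewrite mxE.
by rewrite sumr_const card_ord -[_ *+ s]mulr_natr; ring.
Qed.

(** Each node has [n - 1] or [m - 1] partners in its own sample, which cancels the within-sample
    weight; only sample means of [x] and [g] survive. *)
Lemma dot_slope_w g x : dot slope_w (interaction_fit (g, x)) =
  (\sum_i usubmx x i 0 - \sum_i usubmx g i 0) / n%:R
  + (\sum_j dsubmx x j 0 - \sum_j dsubmx g j 0) / m%:R.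
Proof.
rewrite slope_wE dot_interaction_fit block_mxKul block_mxKur block_mxKdr.
rewrite !dot_const_Zmx.
set c := (n%:R * m%:R)^-1; set u := usubmx x; set v := dsubmx x.
have -> : \sum_(i < n) \sum_(j < m)
    (const_mx c : 'M[R]_(n, m)) i j * (u i 0 + v j 0)
  = c * (m%:R * \sum_i u i 0 + n%:R * \sum_j v j 0).
  transitivity (\sum_i c * (m%:R * u i 0 + \sum_j v j 0)).
    apply: eq_bigr => i _; rewrite mulrDr mulr_natl.
    rewrite -[in _ *+ m](card_ord m) -sumr_const.
    rewrite !mulr_sumr -big_split /=; apply: eq_bigr => j _.
    by rewrite mxE mulrDr.
  rewrite -mulr_sumr big_split /= -mulr_sumr sumr_const card_ord.
  by rewrite [n%:R * _]mulr_natl.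
by rewrite /c; field; rewrite n_neq0 m_neq0 n1_neq0 m1_neq0.
Qed.

Lemma dot_slope_w_vecE B : dot slope_w (vecE B) = energy B / 2.
Proof.
rewrite slope_wE dotC dot_vecE_block !dot_vecE /energy meanXYE meanXXE meanYYE.
have cstE s (D : 'M[R]_s) c :
    \sum_(i < s) \sum_(j < s | (i < j)%N) D i j * (const_mx c : 'M[R]_s) i j
    = c * \sum_(i < s) \sum_(j < s | (i < j)%N) D i j.
  rewrite mulr_sumr; apply: eq_bigr => i _; rewrite mulr_sumr.
  by apply: eq_bigr => j _; rewrite mxE mulrC.
rewrite !cstE.
have -> : \sum_i \sum_j ursubmx B i j
      * (const_mx (n%:R * m%:R)^-1 : 'M[R]_(n, m)) i j
    = (n%:R * m%:R)^-1 * \sum_i \sum_j ursubmx B i j.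
  rewrite mulr_sumr; apply: eq_bigr => i _; rewrite mulr_sumr.
  by apply: eq_bigr => j _; rewrite [X in _ * X]mxE mulrC.
by field; rewrite n_neq0 m_neq0 n1_neq0 m1_neq0.
Qed.

Lemma sum_const_cV s (c : R) :
  \sum_(i < s) (const_mx c : 'cV[R]_s) i 0 = c * s%:R.
Proof.
rewrite (eq_bigr (fun=> c)) => [|j _]; last by rewrite mxE.
by rewrite sumr_const card_ord mulr_natr.
Qed.

Lemma sum_add_const s (h : 'cV[R]_s) c :
  \sum_i (h + const_mx c) i 0 = \sum_i h i 0 + c * s%:R.
Proof.
by rewrite -sum_const_cV -big_split; apply: eq_bigr => i _; rewrite mxE.
Qed.

Lemma usubmx_const c : usubmx (const_mx c : 'cV[R]_N) = const_mx c.
Proof. by apply/colP => i; rewrite !mxE. Qed.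

Lemma dsubmx_const c : dsubmx (const_mx c : 'cV[R]_N) = const_mx c.
Proof. by apply/colP => i; rewrite !mxE. Qed.

Lemma anm_sqr : anm R n m ^+ 2 = sqnorm slope_w.
Proof.
have ge1 (s : nat) : (3 <= s)%N -> 0 <= s%:R - 1 :> R.
  by move=> h; rewrite subr_ge0 ler1n (leq_trans _ h).
rewrite sqr_sqrtr; last first.
  by rewrite !addr_ge0 // divr_ge0 ?mulr_ge0 ?ler0n ?ge1.
(* One copy of [slope_w] is read as a fit, so that [dot_slope_w] evaluates the norm from sample
   means of constants. *)
rewrite sqnorm_dot {2}/slope_w dot_slope_w /slope_w_nodes col_mxKu col_mxKd.
rewrite usubmx_const dsubmx_const !sum_const_cV; field.
by rewrite n_neq0 m_neq0 n1_neq0 m1_neq0.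
Qed.

(** * Fitted spaces and slopes of both models *)

Lemma interaction_fit_common g : interaction_fit (g, g) = Zmx R N *m g.
Proof. by apply/colP => e; rewrite Zmx_mul mxE /=; ring. Qed.

Lemma rmeanE (p : rparam R n m) :
  rmean p = interaction_fit (p.1, p.1 + const_mx (rtheta p / 2)).
Proof.
apply/colP => e; rewrite [LHS]mxE Zmx_mul [RHS]mxE /=.
rewrite [X in _ + X = _]mxE [X in _ + _ * X = _]mxE.
have addE (c : R) i : (p.1 + const_mx c) i 0 = p.1 i 0 + c by rewrite !mxE.
by rewrite !addE; field.
Qed.

(** The array [Qmx] equals 1 on XX, -1 on YY and 0 on XY, so the intercept is [eta + delta],
    [eta - delta] and [eta + theta] on the three blocks; half of it goes to each endpoint. *)
Lemma fmeanE (p : fparam R n m) : fmean p = interaction_fit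
  (p.2.1 + col_mx (const_mx ((feta p + fdelta p) / 2))
                  (const_mx ((feta p - fdelta p) / 2)),
   p.2.2 + const_mx ((feta p + ftheta p) / 2)).
Proof.
apply/colP => e; rewrite mxE [RHS]mxE Cmx_block /falpha /fbeta mxE /=.
case: (split_ordP (esrc e)) => i ->; case: (split_ordP (etgt e)) => j ->;
  rewrite ?glabel_lshift ?glabel_rshift ?block_mxEul ?block_mxEur ?block_mxEdl
    ?block_mxEdr !(col_mxEu, col_mxEd, mxE) /=; by field.
Qed.


(** The coefficient of [Cmx] is [anm ^+ 2]: the slope of the vector [slope_w] itself is its pairing
    with [slope_w]. *)
Lemma slope_w_rmean :
  slope_w = rmean ((slope_w_nodes, (n%:R * m%:R)^-1 + (2 * n%:R * (n%:R - 1))^-1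
                                + (2 * m%:R * (m%:R - 1))^-1) : rparam R n m).
Proof.
rewrite rmeanE /slope_w !interaction_fit_block /rtheta /slope_w_nodes /=.
congr (vecE (block_mx _ _ _ _)); apply/matrixP => i j;
  rewrite mxE [RHS]mxE !linearD /= ?col_mxKu ?col_mxKd !mxE //;
  by field; rewrite n_neq0 m_neq0 n1_neq0 m1_neq0.
Qed.

Lemma restricted_fittedP v : reflect (exists p, v = rmean (p : rparam R n m))
  (v \in fitted_space (restricted_model R n m)).
Proof.
apply: (iffP memv_imgP) => [[p _ ->]|[p ->]]; exists p.
- exact: mean_restrictedE.
- exact: memvf.
- by rewrite mean_restrictedE.
Qed.

Lemma full_fittedP v : reflect (exists p, v = interaction_fit p)
  (v \in fitted_space (full_model R n m)).
Proof.
apply: (iffP memv_imgP) => [[p _ ->]|[[g x] ->]].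
  by rewrite mean_fullE fmeanE; eexists; reflexivity.
pose a := (\sum_i usubmx g i 0) / n%:R; pose b := (\sum_i dsubmx g i 0) / m%:R.
pose c := (\sum_i usubmx x i 0) / n%:R; pose d := (\sum_i dsubmx x i 0) / m%:R.
(* Subtracting the sample means meets the constraints. The removed intercepts are [2 * a] on XX,
   [2 * b] on YY and [c + d] on XY; solving for [eta], [delta] and [theta] gives this witness. *)
exists (a + b, a - b, c + d - a - b,
        (g - col_mx (const_mx a) (const_mx b),
         x - col_mx (const_mx c) (const_mx d))).
  apply/admissible_fullP; rewrite !sumXE !sumYE /falpha /fbeta /=.
  have centered s (h : 'cV[R]_s) (f : 'I_s -> R) : s%:R != 0 :> R ->
      (forall i, f i = h i 0 - (\sum_i h i 0) / s%:R) -> \sum_i f i = 0.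
    move=> s0 fE; rewrite (eq_bigr _ (fun i _ => fE i)) sumrB sumr_const.
    rewrite card_ord -[X in _ - X]mulr_natr.
    by rewrite divfK // subrr.
  by split; [apply: (centered _ (usubmx g))|apply: (centered _ (dsubmx g))
    |apply: (centered _ (usubmx x))|apply: (centered _ (dsubmx x))] => // i;
    rewrite !(col_mxEu, col_mxEd, mxE).
rewrite mean_fullE fmeanE /feta /fdelta /ftheta /= !interaction_fit_block.
congr (vecE (block_mx _ _ _ _)); apply/matrixP => i j;
  rewrite mxE [RHS]mxE !linearD !linearN /= ?col_mxKu ?col_mxKd !mxE;
  by field; rewrite ?n_neq0 ?m_neq0.
Qed.

Lemma nested_models :
  (fitted_space (restricted_model R n m) <= fitted_space (full_model R n m))%VS.
Proof.
apply/subvP => v /restricted_fittedP[p ->]; apply/full_fittedP.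
by rewrite rmeanE; eexists; reflexivity.
Qed.

Lemma rtheta_slope (p : rparam R n m) : rtheta p = dot slope_w (rmean p).
Proof.
rewrite rmeanE dot_slope_w !linearD /= usubmx_const dsubmx_const.
by rewrite !sum_add_const; field; rewrite n_neq0 m_neq0.
Qed.

(** The four constraints remove [alpha] and [beta] from the sample means, and [eta] and [delta]
    cancel between the two samples. *)
Lemma ftheta_slope p : p \in admissible (full_model R n m) ->
  ftheta p = dot slope_w (lm_mean (full_model R n m) p).
Proof.
move=> /admissible_fullP; rewrite !sumXE !sumYE => -[aX aY bX bY].
rewrite mean_fullE fmeanE dot_slope_w !linearD /= !col_mxKu !col_mxKd.
rewrite usubmx_const dsubmx_const !sum_add_const.
have uE (h : 'cV[R]_N) : \sum_i usubmx h i 0 = \sum_i h (lshift m i) 0.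
  by apply: eq_bigr => i _; rewrite mxE.
have dE (h : 'cV[R]_N) : \sum_i dsubmx h i 0 = \sum_i h (rshift n i) 0.
  by apply: eq_bigr => i _; rewrite mxE.
rewrite !uE !dE [X in X + _ - _]bX [X in _ - (X + _)]aX.
rewrite [X in _ + (X + _ - _) / _]bY [X in _ + (_ - (X + _)) / _]aY.
by field; rewrite n_neq0 m_neq0.
Qed.


(** * Dimensions of the fitted spaces *)

Lemma dim_restricted : \dim (fitted_space (restricted_model R n m)) = N.+1.
Proof.
rewrite /fitted_space limg_dim_eq ?dimvf.
  have -> : dim (rparam R n m) = (N * 1 + 1)%N by [].
  by rewrite muln1 addn1.
apply/eqP; rewrite -subv0; apply/subvP => p; rewrite memv_cap memv_ker.
rewrite mean_restrictedE => /andP[_ /eqP p0]; rewrite memv0.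
(* The parametrization is injective: pairing with [slope_w] kills [theta], then injectivity of [Zmx]
   kills [gamma]. *)
have t0 : rtheta p = 0 by rewrite rtheta_slope p0 dotC dot0l.
move: p0; rewrite /rmean t0 scale0r addr0 => /Zmx_inj p0.
apply/eqP; case: p t0 p0 => g t /= t0 g0; congr (_, _) => //.
apply: g0; exact: leq_trans (leq_addr _ _).
Qed.

(** Rank-nullity for the free parametrization with [N + N] coordinates: its kernel is the line that
    raises [x] on one sample and lowers it equally on the other. *)
Lemma dim_full : (\dim (fitted_space (full_model R n m))).+1 = (N + N)%N.
Proof.
pose G := linfun interaction_fit.
have -> : fitted_space (full_model R n m) = limg G.
  apply/vspaceP => v; apply/idP/idP => [/full_fittedP[p ->]|/memv_imgP[p _ ->]].
    by apply/memv_imgP; exists p; rewrite ?memvf ?lfunE.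
  by apply/full_fittedP; exists p; rewrite lfunE.
pose i0 := Ordinal (ltn_trans (ltn0Sn 1) n_ge3).
pose j0 := Ordinal (ltn_trans (ltn0Sn 1) m_ge3).
pose u : 'cV[R]_N * 'cV[R]_N := (0, col_mx (const_mx 1) (const_mx (- 1))).
have kerG : lker G = <[u]>%VS.
  apply/vspaceP => -[g x]; rewrite memv_ker lfunE /=.
  apply/idP/idP => [/eqP p0|/vlineP[k ->]]; last first.
    rewrite linearZ /= (_ : interaction_fit u = 0) ?scaler0 //.
    rewrite /u interaction_fit_block !linear0 col_mxKu col_mxKd.
    apply/colP => e; rewrite mxE [RHS]mxE.
    by case: (split_ordP (esrc e)) => i ->; case: (split_ordP (etgt e)) => j ->;
      rewrite ?block_mxEul ?block_mxEur ?block_mxEdl ?block_mxEdr !mxE; ring.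
  have /eqP : sqnorm (interaction_fit (g, x)) = 0.
    by rewrite p0 sqnorm_dot dot0l.
  rewrite interaction_fit_block sqnorm_vecE_block -!Zmx_vecE.
  rewrite !paddr_eq0 ?addr_ge0 ?sqnorm_ge0 //.
  case/andP => /andP[/eqP/sqnorm_eq0 x0 /eqP/sqnorm_eq0/Zmx_inj gX].
  move=> /eqP/sqnorm_eq0/Zmx_inj gY.
  (* Both indices are free, so [x] is constant on each sample; [i0] and [j0] serve as base points to
     read the constant off. *)
  have xE i j : usubmx x i 0 = - dsubmx x j 0.
    move/matrixP: x0 => /(_ i j); rewrite mxE [RHS]mxE => /eqP.
    by rewrite addr_eq0 => /eqP.
  apply/vlineP; exists (usubmx x i0 0).
  rewrite -[g]vsubmxK -[x in LHS]vsubmxK gX // gY // col_mx0.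
  rewrite /u; congr (_, _); rewrite ?scaler0 // scale_col_mx.
  congr col_mx; apply/colP => i; rewrite [RHS]mxE [const_mx _ _ _]mxE.
    by rewrite (xE i j0) (xE i0 j0) mulr1.
  by rewrite (xE i0 i) mulrN1 opprK.
have := limg_ker_dim G fullv; rewrite capfv kerG dim_vline dimvf.
have -> : u != 0.
  apply/negP => /eqP[] /colP/(_ (lshift m i0))/eqP.
  by rewrite col_mxEu !mxE oner_eq0.
have -> : dim ('cV[R]_N * 'cV[R]_N)%type = (N * 1 + N * 1)%N by [].
by rewrite add1n muln1.
Qed.


(** * Residual of the full model *)

Definition full_residual B : 'M[R]_N :=
  let D := centering R n *m ursubmx B *m centering R m in
  block_mx (ucenter (ulsubmx B)) D D^T (ucenter (drsubmx B)).

Lemma centering_const s : centering R s *m (const_mx 1 : 'cV[R]_s) = 0.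
Proof.
have [->|s_gt0] := posnP s; first by apply/colP => -[].
apply/colP => i; rewrite /centering mulmxBl mul1mx mxE [const_mx _ _ _]mxE.
rewrite !mxE (eq_bigr (fun=> s%:R^-1)) => [|j _]; last by rewrite !mxE mulr1.
rewrite sumr_const card_ord -[_ *+ s]mulr_natl divff ?subrr //.
by rewrite pnatr_eq0 -lt0n.
Qed.

Lemma centering_tr s : (centering R s)^T = centering R s.
Proof. by rewrite /centering linearB /= trmx1 trmx_const. Qed.

Lemma sum_mul_centering s t (D : 'M[R]_(s, t)) i :
  \sum_j (D *m centering R t) i j = 0.
Proof.
transitivity ((D *m centering R t *m (const_mx 1 : 'cV_t)) i 0).
  by rewrite [RHS]mxE; apply: eq_bigr => j _; rewrite [X in _ * X]mxE mulr1.
by rewrite -mulmxA centering_const mulmx0 mxE.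
Qed.

Lemma centering_decomp (D : 'M[R]_(n, m)) :
  exists u : 'cV[R]_n, exists v : 'cV[R]_m,
  forall i j, D i j - (centering R n *m D *m centering R m) i j
              = u i 0 + v j 0.
Proof.
pose E := centering R n *m D.
(* Row means of the column-centred [E], and column means of [D]: centering in two stages removes
   exactly these. *)
exists (\col_i \sum_k E i k * m%:R^-1), (\col_j \sum_k n%:R^-1 * D k j).
move=> i j; rewrite -/E [centering R m]/centering mulmxBr mulmx1.
set C := const_mx m%:R^-1.
transitivity ((D - (E - E *m C)) i j).
  by rewrite [RHS]mxE [X in _ = _ + X]mxE.
have -> : D - (E - E *m C) = E *m C + const_mx n%:R^-1 *m D.
  by rewrite opprB addrCA {2}/E mulmxBl mul1mx subKr.
rewrite mxE; congr (_ + _); rewrite [LHS]mxE [RHS]mxE; apply: eq_bigr => k _.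
  by rewrite [X in _ * X = _]mxE.
by rewrite [X in X * _ = _]mxE.
Qed.

Lemma blockXX_sym B : (forall i j, B i j = B j i) ->
  forall i j, blockXX B i j = blockXX B j i.
Proof. by move=> BC i j; rewrite !mxE BC. Qed.

Lemma blockYY_sym B : (forall i j, B i j = B j i) ->
  forall i j, blockYY B i j = blockYY B j i.
Proof. by move=> BC i j; rewrite !mxE BC. Qed.

Lemma full_lsq_residual B : (forall i j, B i j = B j i) ->
  lsq_residual (full_model R n m) (vecE B) (vecE (full_residual B)).
Proof.
move=> BC.
have XC := blockXX_sym BC; have YC := blockYY_sym BC.
split=> [|v /full_fittedP[[g x] ->]].
  have [g1 hX] := ucenter_decomp n_ge3 (ulsubmx B).
  have [g2 hY] := ucenter_decomp m_ge3 (drsubmx B).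
  have [u [v hXY]] := centering_decomp (ursubmx B).
  apply/full_fittedP; exists (col_mx g1 g2, col_mx u v).
  rewrite interaction_fit_block !col_mxKu !col_mxKd.
  apply/colP => e; rewrite [LHS]mxE [X in X + _ = _]mxE [X in _ + X = _]mxE.
  rewrite [X in _ - X = _]mxE [RHS]mxE -{1}[B]submxK /full_residual.
  (* Distinct endpoints are what [ucenter_decomp] asks for, and their order excludes a source in the
     second sample with a target in the first. *)
  have ne := edge_neq e; have := edge_lt e; move: ne.
  case: (split_ordP (esrc e)) => i ->; case: (split_ordP (etgt e)) => j -> ne;
    rewrite ?block_mxEul ?block_mxEur ?block_mxEdl ?block_mxEdr.
  - by rewrite eq_lshift in ne; rewrite hX // [RHS]mxE.
  - by rewrite hXY [RHS]mxE.
  - by rewrite /= ltnNge ltnW // ltn_addr.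
  - by rewrite eq_rshift in ne; rewrite hY // [RHS]mxE.
apply: dot_interaction_fit0; rewrite ?block_mxKul ?block_mxKur ?block_mxKdr.
- by move=> h; exact: vecE_ucenter_orth.
- by move=> h; exact: vecE_ucenter_orth.
- exact: sum_mul_centering.
- move=> j.
  (* Column sums are row sums of the transpose, which is again doubly centred. *)
  rewrite -[RHS](sum_mul_centering (centering R m *m (ursubmx B)^T) j).
  apply: eq_bigr => i _.
  transitivity ((centering R n *m ursubmx B *m centering R m)^T j i).
    by rewrite [RHS]mxE.
  by rewrite !trmx_mul !centering_tr mulmxA.
Qed.

Lemma full_residual_sqnorm B : (forall i j, B i j = B j i) ->
  sqnorm (vecE (full_residual B)) =
  sqnorm (centering R n *m blockXY B *m centering R m)
  + quad (M2 R n) (vecE (blockXX B)) + quad (M2 R m) (vecE (blockYY B)).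
Proof.
move=> BC; rewrite sqnorm_vecE_block !quad_M2_vecE //.
  exact: blockYY_sym.
exact: blockXX_sym.
Qed.

(** * Residual of the restricted model *)

Let N_ge3 : (3 <= N)%N. Proof. exact: leq_trans (leq_addr _ _). Qed.

Lemma dot_slope_w_Zmx g : dot slope_w (Zmx R N *m g) = 0.
Proof. by rewrite -interaction_fit_common dot_slope_w !subrr !mul0r addr0. Qed.

Lemma slope_w_neq0 : dot slope_w slope_w != 0.
Proof.
apply/eqP => /dot_eq0 w0.
have := rtheta_slope ((0, 1) : rparam R n m).
by rewrite w0 dot0l /rtheta /= => /eqP; rewrite oner_eq0.
Qed.

Definition restricted_residual (a : 'cV[R]_(nedge N)) : 'cV[R]_(nedge N) :=
  M2 R N *m a - (dot slope_w a / dot slope_w slope_w) *: slope_w.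

Lemma dot_slope_w_M2 a : dot slope_w (M2 R N *m a) = dot slope_w a.
Proof.
have [g ag] := M2_decomp a.
by rewrite -[a in RHS](subrK (M2 R N *m a)) ag dotDr dot_slope_w_Zmx add0r.
Qed.

Lemma restricted_lsq_residual a :
  lsq_residual (restricted_model R n m) a (restricted_residual a).
Proof.
have wF : slope_w \in fitted_space (restricted_model R n m).
  by apply/restricted_fittedP; rewrite slope_w_rmean; eexists; reflexivity.
have [g ag] := M2_decomp a.
have ZF h : Zmx R N *m h \in fitted_space (restricted_model R n m).
  apply/restricted_fittedP; exists (h, 0).
  by rewrite /rmean /rtheta /= scale0r addr0.
split=> [|v /restricted_fittedP[p ->]].
  by rewrite opprB addrCA [a - _]ag addrC rpredD ?ZF // rpredZ.
have rZ h : dot (restricted_residual a) (Zmx R N *m h) = 0.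
  by rewrite dotBl dotZl dot_slope_w_Zmx M2_orth // mulr0 subr0.
have rw : dot (restricted_residual a) slope_w = 0.
  by rewrite dotC dotBr dotZr dot_slope_w_M2 divfK ?slope_w_neq0 // subrr.
(* Modulo the range of [Zmx], [slope_w] is a positive multiple of the edge vector of [Cmx], so
   orthogonality to [slope_w] passes to that vector. *)
move: rw; rewrite slope_w_rmean {1}/rmean dotDr rZ add0r dotZr /rtheta /=.
move=> /eqP; rewrite mulf_eq0 => /orP[|/eqP rC]; last first.
  by rewrite /rmean dotDr rZ dotZr rC mulr0 addr0.
have ge1 (s : nat) : (3 <= s)%N -> 0 < s%:R - 1 :> R.
  by move=> h; rewrite subr_gt0 ltr1n (leq_trans _ h).
have n_gt0 : (0 < n)%N by exact: ltn_trans n_ge3.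
have m_gt0 : (0 < m)%N by exact: ltn_trans m_ge3.
by rewrite gt_eqF // !addr_gt0 ?invr_gt0 ?mulr_gt0 ?mulr_gt0 ?ge1 ?ltr0n.
Qed.

(** Because [slope_w] pairs equally with [a] and [M2 a], the cross term is twice the square term and
    one subtraction remains. *)
Lemma restricted_residual_sqnorm a : sqnorm (restricted_residual a) =
  quad (M2 R N) a - dot slope_w a ^+ 2 / anm R n m ^+ 2.
Proof.
rewrite anm_sqr quad_M2 // !sqnorm_dot dotBr !dotBl !dotZl !dotZr.
rewrite (dotC (_ *m _) slope_w) !dot_slope_w_M2; field.
exact: slope_w_neq0.
Qed.

End TwoSamples.

(** * Edge count over the reals, and the assembly of all claims *)

Lemma nedge_natr (R : realType) s : (nedge s)%:R = s%:R * (s%:R - 1) / 2 :> R.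
Proof.
rewrite nedgeE; case: s => [|s]; first by rewrite bin0n /= !mul0r.
have /(congr1 (fun k => k%:R : R)) : (2 * 'C(s.+1, 2) = s.+1 * s)%N.
  by rewrite -mul_bin_diag bin1.
rewrite !natrM -[s.+1%:R]natr1 addrK => <-.
by rewrite mulrAC divff ?mul1r // pnatr_eq0.
Qed.

Theorem proposition4p3 (R : realType) (d d' : measure_display)
    (Om : measurableType d) (Z : measurableType d') (Pr : probability Om R)
    (P Q : probability Z R) (rho : Z -> Z -> R) (n m : nat)
    (X : 'I_n -> {mfun Om >-> Z}) (Y : 'I_m -> {mfun Om >-> Z})
    (n_ge4 : (4 <= n)%N) (m_ge4 : (4 <= m)%N)
    (samples : two_samples Pr P Q X Y) (rhoP : dissimilarity P Q rho)
    (omega : Om) :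
  let N := (n + m)%N in
  let A := Amx rho (pool (fun i => X i omega) (fun j => Y j omega)) in
  let aE := vecE A in
  let F := full_model R n m in
  let F_R := restricted_model R n m in
  let nuF := resid_df F in
  let nuR := resid_df F_R in
  [/\ exists pF, is_lse F aE pF,
      exists pR, is_lse F_R aE pR,
      exists w, slope_vector F (@ftheta R n m) w
    & forall pF pR w, is_lse F aE pF -> is_lse F_R aE pR ->
        slope_vector F (@ftheta R n m) w ->
      let RSSF := rss F aE pF in
      let RSSR := rss F_R aE pR in
      let MSF := RSSF / nuF in
      let SSint := sqnorm (lm_mean F pF - lm_mean F_R pR) in
      [/\ ftheta pF = energy A / 2,
          RSSF = sqnorm (centering R n *m blockXY A *m centering R m)
                 + quad (M2 R n) (vecE (blockXX A))
                 + quad (M2 R m) (vecE (blockYY A)),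
          nuF = (n%:R - 1) * (m%:R - 1) + n%:R * (n%:R - 3) / 2
                + m%:R * (m%:R - 3) / 2
          /\ nuF = 'C(N, 2)%:R - 2 * N%:R + 1,
          czvar A = 4 * MSF
          /\ (0 < RSSF ->
              [/\ ols_tstat (ftheta pF) MSF w
                    = ftheta pF / (anm R n m * Num.sqrt MSF),
                  ols_tstat (ftheta pF) MSF w
                    = energy A / (anm R n m * Num.sqrt (czvar A))
                & ols_tstat (ftheta pF) MSF w = czstat A])
        & [/\ (fitted_space F_R <= fitted_space F)%VS,
              [/\ rtheta pR = energy A / 2,
                  RSSR = quad (M2 R N) aE - rtheta pR ^+ 2 / anm R n m ^+ 2
                & nuR = 'C(N, 2)%:R - N%:R - 1],
              RSSR = RSSF + SSint,
              0 <= SSint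
            & nuR - nuF = N%:R - 2]]].
Proof.
move=> N A aE F F_R nuF nuR.
have n3 := ltnW n_ge4; have m3 := ltnW m_ge4.
have AC i j : A i j = A j i.
  by rewrite !mxE eq_sym; case: eqP => // _; case: rhoP => rhoC _ _ _ _.
have resF := full_lsq_residual n3 m3 AC.
have resR := restricted_lsq_residual n3 m3 aE.
have w_fitR : slope_w R n m \in fitted_space F_R.
  by apply/restricted_fittedP; rewrite slope_w_rmean //; eexists; reflexivity.
have nested := nested_models R n3 m3.
have w_fitF := subvP nested _ w_fitR.
have w_slope : slope_vector F (@ftheta R n m) (slope_w R n m).
  by apply: slope_vectorW => // p; exact: ftheta_slope.
split; first exact: lsq_residual_lse resF.
- exact: lsq_residual_lse resR.
- by exists (slope_w R n m).
move=> pF pR w hF hR hw RSSF RSSR MSF SSint.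
(* Uniqueness turns the arbitrary slope vector into the explicit one, whose norm is known. *)
have -> : w = slope_w R n m by exact: slope_vector_uniq hw w_slope.
have thF : ftheta pF = energy A / 2.
  by case: w_slope => _ /(_ _ _ hF) ->; exact: dot_slope_w_vecE.
have thR : rtheta pR = energy A / 2.
  rewrite -dot_slope_w_vecE //; apply: slope_lse hR => // q _.
  by rewrite mean_restrictedE; exact: rtheta_slope.
have RSSFE : RSSF = sqnorm (vecE (full_residual A)) by exact: lse_rss resF hF.
have nuFE : nuF = 'C(N, 2)%:R - 2 * N%:R + 1.
  rewrite /nuF /resid_df -nedgeE -/N; have := dim_full R n3 m3.
  move=> /(congr1 (fun k => k%:R : R)); rewrite -natr1 natrD -/N => dimE.
  rewrite (_ : (\dim _)%:R = N%:R + N%:R - 1); last by rewrite -dimE addrK.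
  by ring.
have nuRE : nuR = 'C(N, 2)%:R - N%:R - 1.
  by rewrite /nuR /resid_df dim_restricted // -nedgeE -natr1 opprD addrA.
have nuFE' : nuF = (n%:R - 1) * (m%:R - 1) + n%:R * (n%:R - 3) / 2
                + m%:R * (m%:R - 3) / 2.
  by rewrite nuFE -nedgeE nedge_natr /N natrD; field.
have ge k : (4 <= k)%N -> 1 <= k%:R - 3 :> R.
  by rewrite -(ler_nat R) => k4; lra.
(* The sign of [nuF] makes [MSF] nonnegative, which splitting the square root in the standard error
   requires. *)
have nuF_gt0 : 0 < nuF.
  have := ge _ n_ge4; have := ge _ m_ge4; rewrite nuFE'; nra.
have czE : czvar A = 4 * MSF.
  rewrite /czvar !Dtilde2E //; last exact: blockXX_sym; last exact: blockYY_sym.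
  rewrite /MSF RSSFE full_residual_sqnorm // nuFE' /vdf /cdCov2.
  have n1 : n%:R - 1 != 0 :> R by have := ge _ n_ge4; lra.
  have m1 : m%:R - 1 != 0 :> R by have := ge _ m_ge4; lra.
  by rewrite [RHS]mulrA; congr (_ / _); field; rewrite n1 m1.
(* By nesting, the difference of the two fits lies in the full fitted space, hence is orthogonal to
   the full residual. *)
have pyth : RSSR = RSSF + SSint.
  rewrite /RSSR /RSSF /SSint /rss.
  rewrite -sqnormD_orth ?subrKA //; case/lseP: hF => pFF; apply.
  rewrite rpredB ?mean_fitted //; apply: subvP nested _ (mean_fitted _).
  by case: hR.
have anm_ge0 : 0 <= anm R n m by exact: sqrtr_ge0.
have tE : 0 < RSSF -> ols_tstat (ftheta pF) MSF (slope_w R n m)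
                    = ftheta pF / (anm R n m * Num.sqrt MSF).
  move=> RSS_gt0; rewrite /ols_tstat -anm_sqr // sqrtrM.
    by rewrite sqrtr_sqr ger0_norm // [_ * anm R n m]mulrC.
  by rewrite divr_ge0 ?ltW.
(* This 2 absorbs the one in [energy A / 2]. *)
have czs : Num.sqrt (czvar A) = 2 * Num.sqrt MSF.
  rewrite czE sqrtrM // (_ : 4 = 2 ^+ 2) ?sqrtr_sqr ?ger0_norm //.
  by rewrite expr2; ring.
have tE' : 0 < RSSF -> ols_tstat (ftheta pF) MSF (slope_w R n m)
                    = energy A / (anm R n m * Num.sqrt (czvar A)).
  move=> RSS_gt0; rewrite tE // czs thF.
  by rewrite [anm R n m * (2 * _)]mulrCA (invfM 2) [RHS]mulrA.
split=> //; first by rewrite RSSFE full_residual_sqnorm.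
  split=> // RSS_gt0; split; [exact: tE|exact: tE'|exact: tE'].
split=> //.
- split=> //; rewrite thR -dot_slope_w_vecE // -restricted_residual_sqnorm //.
  exact: lse_rss hR.
- exact: sqnorm_ge0.
- by rewrite nuRE nuFE; ring.
Qed.
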